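(* Let $\mathcal{A}$ be a hyperplane arrangement in $\mathbb{R}^n$. Then, in the polynomial ring $R_{\mathcal{A}}$, $$\det\big(\mathrm{v}(D,C)\big)_{C,D \in C_{\mathcal{A}}} = \prod_{F \in F_{\mathcal{A}} \setminus C_{\mathcal{A}}} (1 - \mathrm{b}_F)^{\beta_F}.$$
   Context: A hyperplane arrangement $\mathcal{A}$ in $\mathbb{R}^n$ is a finite set of affine hyperplanes of $\mathbb{R}^n$. For each hyperplane $H$, let $H^+$ and $H^-$ be the two connected open half-spaces bounded by $H$ (with a fixed choice of labels), and $H^0 := H$. A face of $\mathcal{A}$ is a nonempty subset of $\mathbb{R}^n$ of the form $F = \bigcap_{H \in \mathcal{A}} H^{\epsilon_H(F)}$ with $\epsilon_H(F) \in \{+,0,-\}$. $F_{\mathcal{A}}$ is the set of faces. A chamber is a face $F$ with $\epsilon_H(F) \neq 0$ for all $H \in \mathcal{A}$; $C_{\mathcal{A}}$ is the set of chambers. Let $h_H^{\varepsilon}$ ($H \in \mathcal{A}$, $\varepsilon \in \{+,-\}$) be independent variables and $R_{\mathcal{A}} := \mathbb{Z}[h_H^{\varepsilon} \mid \varepsilon \in \{+,-\}, H \in \mathcal{A}]$. For chambers $C,D \in C_{\mathcal{A}}$ let $\mathscr{H}(C,D) := \{H^{\epsilon_H(C)} \mid H \in \mathcal{A},\ \epsilon_H(C) = -\epsilon_H(D)\}$, and define $\mathrm{v}(C,C) = 1$ and $\mathrm{v}(C,D) = \prod_{H^{\varepsilon} \in \mathscr{H}(C,D)} h_H^{\varepsilon}$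 if $C \neq D$. For $F \in F_{\mathcal{A}} \setminus C_{\mathcal{A}}$: $\mathcal{A}_F := \{H \in \mathcal{A} \mid F \subseteq H\}$; the weight of $F$ is $\mathrm{b}_F := \prod_{H \in \mathcal{A}_F} h_H^+ h_H^-$; and the multiplicity of $F$ is the integer $$\beta_F := \frac{\#\{C \in C_{\mathcal{A}} \mid \overline{C} \cap H = \overline{F}\}}{2},$$ where $H$ is any chosen hyperplane in $\mathcal{A}_F$ (the value is independent of the choice of $H$). Here $\overline{S}$ denotes the topological closure of $S \subseteq \mathbb{R}^n$. *)

(* Defs.v *)
From HB Require Import structures.
From mathcomp Require Import all_boot all_order all_algebra.
From mathcomp Require Import -(notations) mpoly.
From mathcomp Require Import boolp classical_sets reals topology normedtype.

Set Implicit Arguments.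
Unset Strict Implicit.
Unset Printing Implicit Defensive.

Import Order.TTheory GRing.Theory Num.Theory.
Import numFieldNormedType.Exports.

Local Open Scope classical_set_scope.
Local Open Scope ring_scope.

Section Arrangement.
Variables (R : realType) (n : nat).

Definition affine_form (a : 'rV[R]_n) (b : R) (x : 'rV[R]_n) : R :=
  \sum_(j < n) a 0 j * x 0 j - b.

(* The finite set of hyperplanes is enumerated without repetition by [I].  The *)
(* pair (normal H, offset H) determines H up to a nonzero scalar, whose sign   *)
(* is the choice of which side of H is labelled +.                             *)
Record arrangement (I : finType) := Arrangement {
  normal : I -> 'rV[R]_n;
  offset : I -> R;
  normal_neq0 : forall H, normal H != 0;
  hyperplane_inj :
    injective (fun H => [set x | affine_form (normal H) (offset H) x = 0])
}.

(* The signs: [Some true] is +, [Some false] is -, and [None] is 0. *)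
Definition sign := option bool.

Variables (I : finType) (A : arrangement I).

Definition part (H : I) (e : sign) : set 'rV[R]_n :=
  let f := affine_form (normal A H) (offset A H) in
  match e with
  | Some true => [set x | 0 < f x]
  | Some false => [set x | f x < 0]
  | None => [set x | f x = 0]
  end.

Definition hyperplane (H : I) : set 'rV[R]_n := part H None.

Definition cell (e : {ffun I -> sign}) : set 'rV[R]_n :=
  \bigcap_(H in [set: I]) part H (e H).

(* A face is recorded by its sign vector; by [face_set_inj] this is the same *)
(* thing as the subset [face_set F] of R^n.                                  *)
Definition face := {e : {ffun I -> sign} | `[< cell e !=set0 >]}.

Definition epsilon (F : face) (H : I) : sign := val F H.

Definition face_set (F : face) : set 'rV[R]_n := cell (val F).

Lemma part_disjoint H e1 e2 x : part H e1 x -> part H e2 x -> e1 = e2.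
Proof.
rewrite /part; set f := affine_form _ _.
case: e1 e2 => [[]|] [[]|] //= h1 h2; exfalso; move: h1 h2.
- by move=> /lt_trans h /h; rewrite ltxx.
- by move=> h1 h2; move: h1; rewrite h2 ltxx.
- by move=> h1 /lt_trans /(_ h1); rewrite ltxx.
- by move=> h1 h2; move: h1; rewrite h2 ltxx.
- by move=> ->; rewrite ltxx.
- by move=> ->; rewrite ltxx.
Qed.

Lemma face_set_inj : injective face_set.
Proof.
move=> F G eqFG; apply/val_inj/ffunP => H.
have /asboolP[x Fx] := valP F.
have Gx : face_set G x by rewrite -eqFG.
exact: (part_disjoint (Fx H Logic.I) (Gx H Logic.I)).
Qed.

Definition chambers : {set face} :=
  [set F : face | [forall H, epsilon F H != None]].

(* The variable h_H^e is indexed by the rank of (H, e) in I * bool. *)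
Definition R_ := mpoly #|{: I * bool}| int.

Definition h (H : I) (e : bool) : R_ := mpolyX int (mnm1 (enum_rank (H, e))).

(* The pair (H, e) stands for the half-space H^e. *)
Definition separating (C D : face) : {set I * bool} :=
  [set p | (epsilon C p.1 == Some p.2) && (epsilon D p.1 == Some (~~ p.2))].

Definition v (C D : face) : R_ :=
  if C == D then 1 else \prod_(p in separating C D) h p.1 p.2.

Definition localization (F : face) : {set I} :=
  [set H | `[< face_set F `<=` hyperplane H >]].

Definition weight (F : face) : R_ :=
  \prod_(H in localization F) (h H true * h H false).

Definition chambers_at (F : face) (H : I) : {set face} :=
  [set C in chambers |
    `[< closure (face_set C) `&` hyperplane H = closure (face_set F) >]].

(* [b] is the multiplicity of F computed with some H containing F.  Halving is *)
(* exact: reversing the signs of a chamber of [chambers_at F H] on the         *)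
(* hyperplanes containing F is a fixed-point-free involution of that set.      *)
Definition is_multiplicity (F : face) (b : nat) : Prop :=
  exists2 H, H \in localization F & b = (#|chambers_at F H|)./2.

Definition varchenko_matrix : 'M[R_]_#|chambers| :=
  \matrix_(i, j) v (enum_val j) (enum_val i).

End Arrangement.

(* Main.v *)
Require Import Defs.
From HB Require Import structures.
From mathcomp Require Import all_boot all_order all_algebra.
From mathcomp Require Import -(notations) mpoly.
From mathcomp Require Import boolp classical_sets reals topology normedtype.
From mathcomp Require Import fintype finset perm ring lra.

Set Implicit Arguments.
Unset Strict Implicit.
Unset Printing Implicit Defensive.

Import Order.TTheory GRing.Theory Num.Theory.
Import numFieldNormedType.Exports.

Local Open Scope ring_scope.

(** The proof is combinatorial: a face is its vector of signs, and the
geometry enters through the closures of the faces ([closure_cell]) and the fact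
that the sign vectors form a conditional oriented matroid ([covectors_com]),
i.e. are closed under X o (-Y), where X o Y takes the sign of X where
it is nonzero and that of Y elsewhere (move from a point of X slightly away
from a point of Y), and under elimination (a segment from X to Y crosses any
hyperplane that separates them).

Let the weights be arbitrary elements w H b of a commutative ring, let V_w be
the matrix of the products v(C, D), and fix a hyperplane e. Setting both weights
of e to 0 gives weights w' for which V_w' is block diagonal, one block for each
side of e. The idea is a factorisation V_w = M V_w' with
  M(C, D) = [C = D] + v(C, D) c(C, D),
where c(C, D) is the sum, over the faces G inside e with G o (-C) = D, of
(-1)^(codimension of G in e) ([distance_factor]). To see it, take C and D on
opposite sides of e and travel from C to D through G o (-C): this multiplies
v(C, D) by h_H^+ h_H^- for each H that does not separate C from D and on which G
does not have the sign of C. So one has to sum the signs of G against a product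
of such factors; writing a factor as h_H^+ h_H^- plus 1 - h_H^+ h_H^- times the
indicator that G and C agree on H reduces this to the Euler characteristic of
a nonempty open convex region of e, which is 1 ([wall_sign_sum]).

The same Euler characteristic shows that c(C, D) vanishes unless every face of C
inside e lies in all the hyperplanes separating C from D ([wall_coef_ne0]): the
faces counted by c(C, D) would otherwise form a cell some of whose walls are
visible from a point of e, and these cancel. Hence, when the chambers C are
ordered by the largest face F_C of C inside e, M is block triangular, and its
diagonal blocks only pair C with its reflection F_C o (-C). Such a pair
contributes 1 - b_F, so
  det M = product over the faces F inside e of (1 - b_F)^(beta_F computed at e)
([det_wall_mx]). Removing the hyperplanes one after another, b_F becomes 0 as
soon as a hyperplane through F has been removed, so F contributes exactly once,
at the first hyperplane through it ([det_distance_mx_on]).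

There remains the choice of the hyperplane at which beta_F is computed
([multiplicity_indep]). The formula just obtained holds for every order on the
hyperplanes. Give weight 2 to the hyperplanes through F and 0 to the others, and
compare two orders on the former: by induction the faces in fewer hyperplanes
contribute the same, the faces in the same hyperplanes as F have the same
multiplicity as F, and the powers of 1 - 4^k are distinct for k > 0. *)

(** * Sign vectors and conditional oriented matroids *)

Section SignVectors.
Variable I : finType.
Local Notation covec := {ffun I -> option bool}.
Implicit Types (X Y Z G C D F : covec) (H K e : I) (O P : {set I}).

Definition neg X : covec := [ffun H => omap negb (X H)].

Definition compose X Y : covec :=
  [ffun H => if X H is Some b then Some b else Y H].

Definition zeros X : {set I} := [set H | X H == None].

Definition face_le X C : bool := [forall H, (X H == None) || (X H == C H)].

Definition agree O X Y : bool := [forall H in O, X H == Y H].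

Definition separators C D : {set I} := [set H | C H != D H].

Lemma face_leP X C :
  reflect (forall H, X H = None \/ X H = C H) (face_le X C).
Proof.
apply: (iffP forallP) => [h H|h H].
  by have /orP[/eqP|/eqP] := h H; [left | right].
by have [->|->] := h H; rewrite eqxx ?orbT.
Qed.

Lemma agreeP O X Y : reflect {in O, X =1 Y} (agree O X Y).
Proof. by apply: (iffP forall_inP) => h H /h; move/eqP. Qed.

Lemma agreeU1 H O X Y : agree (H |: O) X Y = (X H == Y H) && agree O X Y.
Proof.
apply/agreeP/andP => [h|[/eqP h1 /agreeP h2] K].
  split; first by rewrite h // setU11.
  by apply/agreeP => K KO; apply: h; rewrite setU1r.
by rewrite in_setU1 => /orP[/eqP->|/h2].
Qed.

Lemma face_le_refl X : face_le X X.
Proof. by apply/face_leP => H; right. Qed.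

Lemma face_le_anti X Y : face_le X Y -> face_le Y X -> X = Y.
Proof.
move=> /face_leP h1 /face_leP h2; apply/ffunP => H.
by case: (h1 H) => // XH; case: (h2 H) => // ->.
Qed.

Lemma face_le_trans X Y Z : face_le X Y -> face_le Y Z -> face_le X Z.
Proof.
move=> /face_leP h1 /face_leP h2; apply/face_leP => H.
by case: (h1 H) => [->|->]; [left | exact: h2].
Qed.

Lemma face_le_compose X Y : face_le X (compose X Y).
Proof.
by apply/face_leP => H; rewrite ffunE; case: (X H); [right | left].
Qed.

Lemma zeros_face_le X C : face_le X C -> zeros C \subset zeros X.
Proof.
move=> /face_leP h; apply/subsetP => H; rewrite !inE => /eqP CH.
by case: (h H) => ->; rewrite ?CH.
Qed.

Lemma face_le_eq X C : face_le X C -> (#|zeros X| <= #|zeros C|)%N -> X = C.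
Proof.
move=> le_XC le_card.
have /eqP eq0 : zeros C == zeros X by rewrite eqEcard zeros_face_le.
move/face_leP: le_XC => le_XC.
apply/ffunP => H; case: (le_XC H) => // XH.
have : H \in zeros C by rewrite eq0 inE XH.
by rewrite inE XH => /eqP.
Qed.

(** Conditional oriented matroids, with elimination stated as a segment from a
point of X to a point of Y gives it: the segment meets H, and keeps the signs
that its two ends share. *)
Record is_com (L : {set covec}) : Prop := IsCom {
  face_symmetry : forall X Y, X \in L -> Y \in L -> compose X (neg Y) \in L;
  elimination : forall X Y H, X \in L -> Y \in L ->
    X H != None -> Y H = omap negb (X H) ->
    exists2 Z, Z \in L & Z H = None /\ forall K, X K = Y K -> Z K = X K }.

Variables (L : {set covec}) (comL : is_com L).

(** Composition is the double reflection X o -(X o -Y). *)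
Lemma compose_com X Y : X \in L -> Y \in L -> compose X Y \in L.
Proof.
move=> XL YL; have := face_symmetry comL XL (face_symmetry comL XL YL).
congr (_ \in L); apply/ffunP => H; rewrite !ffunE.
by case: (X H) (Y H) => [b|] // [[]|].
Qed.

Definition topes : {set covec} := [set C in L | zeros C == set0].

Lemma topesP C : reflect (C \in L /\ forall H, C H != None) (C \in topes).
Proof.
rewrite inE; apply: (iffP andP) => [[-> /eqP C0]|[-> C0]]; split=> //.
  by move=> H; apply/negP => CH; have := in_set0 H; rewrite -C0 inE CH.
by apply/eqP/setP => H; rewrite !inE; apply: negbTE.
Qed.

Section EulerCharacteristic.
Variable R : comNzRingType.

(** The sign (-1)^(codimension of G), without dimensions: running through the
hyperplanes of [r], the codimension goes up by one at each hyperplane that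
contains G but not the face cut out by G on the hyperplanes already in [P].
These hyperplanes are the basis that the greedy algorithm finds for the flat of
G. *)
Fixpoint greedy_sign P (r : seq I) G : R :=
  if r is H :: r' then
    (if (G H == None) && [exists W in L, agree P W G && (W H != None)]
     then -1 else 1) * greedy_sign (H |: P) r' G
  else 1.

(** The signed count of the faces of an open convex region is 1: [agree O G C]
describes such a region of the flat given by [Y] on [P], and adding a hyperplane
H either leaves a face whole or splits it into three, of signs s, -s and s. When
a face is split and both outer parts meet the region, so does the middle one,
by elimination; when the middle part meets it, both outer ones do, by
composition. *)
Lemma greedy_sign_sum C O P r Y :
    uniq r -> (forall H, (H \in r) = (H \notin P)) ->
    {in O, forall H, C H != None} ->
  \sum_(G in L | agree P G Y && agree O G C) greedy_sign P r G
    = [exists G in L, agree P G Y && agree O G C]%:R.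
Proof.
move=> + + C0; elim: r P Y => [|H r IH] P Y /=.
  move=> _ rP; have PT H : H \in P by apply/negbFE; rewrite -rP.
  have eqGY G : agree P G Y -> G = Y.
    by move=> /agreeP h; apply/ffunP => H; apply: h.
  have [/exists_inP[G GL hG]|/exists_inPn hN] :=
      boolP [exists G in L, agree P G Y && agree O G C].
    rewrite (big_pred1 G) // => Z; case/andP: hG => /eqGY GY hO.
    apply/andP/eqP => [[_ /andP[/eqGY ->]]//|->].
    by rewrite GL hO GY andbT; split=> //; apply/agreeP.
  rewrite big_pred0 // => G; apply/negP => /andP[GL hG].
  by have := hN G GL; rewrite hG.
move=> /andP[Hr ur] rP.
have HP : H \notin P by rewrite -rP mem_head.
pose set_sign (s : option bool) := [ffun K => if K == H then s else Y K] : covec.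
have agr_set G s :
    agree (H |: P) G (set_sign s) = (G H == s) && agree P G Y.
  rewrite agreeU1 ffunE eqxx; congr (_ && _).
  apply/agreeP/agreeP => h K KP.
    by rewrite h // ffunE; case: eqP KP HP => // -> ->.
  by rewrite ffunE h //; case: eqP KP HP => // -> ->.
have rP' K : (K \in r) = (K \notin H |: P).
  by have := rP K; rewrite !inE; case: eqP => // ->; rewrite (negbTE Hr).
pose U s G := (G H == s) && (agree P G Y && agree O G C).
pose a s := [exists G in L, U s G].
pose w : R := if [exists W in L, agree P W Y && (W H != None)] then -1 else 1.
have sumU s : \sum_(G in L | U s G) greedy_sign P (H :: r) G
    = (if s == None then w else 1) * (a s)%:R.
  transitivity (\sum_(G in L | agree (H |: P) G (set_sign s) && agree O G C)
      (if s == None then w else 1) * greedy_sign (H |: P) r G).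
    apply: eq_big => [G|G /andP[GL /andP[/eqP GH /andP[GY GO]]]].
      by rewrite agr_set /U -andbA.
    rewrite /= GH; congr (_ * _); case: eqP => //= _; rewrite /w.
    congr (if _ then _ else _); apply: eq_existsb => W; congr (_ && (_ && _)).
    apply/agreeP/agreeP => h K KP; rewrite h //;
      by [rewrite (agreeP _ _ _ GY) | rewrite -(agreeP _ _ _ GY)].
  rewrite -mulr_sumr IH //; congr (_ * (nat_of_bool _)%:R).
  by apply: eq_existsb => G; rewrite agr_set /U -!andbA.
have split_sign (V : nmodType) (f : covec -> V) (Q : pred covec) :
    \sum_(G | Q G) f G = \sum_(G | Q G && (G H == None)) f G
      + (\sum_(G | Q G && (G H == Some true)) f G
       + \sum_(G | Q G && (G H == Some false)) f G).
  rewrite (bigID (fun G : covec => G H == None)) /=; congr (_ + _).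
  rewrite (bigID (fun G : covec => G H == Some true)) /=; congr (_ + _).
    by apply: eq_bigl => G; case: (G H) => [[]|]; rewrite ?andbT ?andbF.
  by apply: eq_bigl => G; case: (G H) => [[]|]; rewrite ?andbT ?andbF.
have UE s : \sum_(G in L | agree P G Y && agree O G C && (G H == s))
    greedy_sign P (H :: r) G = (if s == None then w else 1) * (a s)%:R.
  by rewrite -sumU; apply: eq_bigl => G; rewrite /U [_ && (G H == s)]andbC.
rewrite split_sign.
under eq_bigl do rewrite -andbA.
under [X in _ + (X + _)]eq_bigl do rewrite -andbA.
under [X in _ + (_ + X)]eq_bigl do rewrite -andbA.
rewrite !UE /= !mul1r.
have aE : [exists G in L, agree P G Y && agree O G C]
    = [|| a None, a (Some true) | a (Some false)].
  apply/exists_inP/or3P => [[G GL hG]|].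
    have aG : a (G H) by apply/exists_inP; exists G => //; rewrite /U eqxx.
    by case: (G H) aG => [[]|]; [constructor 2|constructor 3|constructor 1].
  by case=> /exists_inP[G GL /andP[_ ?]]; exists G.
(* A region meeting both sides of H meets H. *)
have a_elim : a (Some true) -> a (Some false) -> a None.
  move=> /exists_inP[G1 G1L /andP[/eqP G1H /andP[/agreeP G1P /agreeP G1O]]].
  move=> /exists_inP[G2 G2L /andP[/eqP G2H /andP[/agreeP G2P /agreeP G2O]]].
  have [||Z ZL [ZH Zagr]] := elimination comL (H := H) G1L G2L;
    rewrite ?G1H ?G2H //.
  apply/exists_inP; exists Z => //; rewrite /U ZH eqxx /=.
  apply/andP; split; apply/agreeP => K hK.
    by rewrite Zagr ?G1P // G2P.
  by rewrite Zagr ?G1O // G2O.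
rewrite aE /w; case: ifP => [/exists_inP[W WL /andP[/agreeP WP WH]]|/negbT].
  (* If H properly cuts the face, a face of the region inside H can be pushed
     off H to either side without leaving the region. *)
  have a_push s : s != None -> a None -> a s.
    move=> s0 /exists_inP[Z ZL /andP[/eqP ZH /andP[/agreeP ZP /agreeP ZO]]].
    have [W' [W'L [W'H W'P]]] : exists Z', compose Z Z' \in L /\
        (Z' H = s /\ forall K, K \in P -> Y K = None -> Z' K = None).
      have [WHs|WHs] := eqVneq (W H) s.
        exists W; split; first exact: compose_com.
        by split=> // K /WP ->.
      exists (neg W); split; first exact: (face_symmetry comL).
      split=> [|K KP YK]; last by rewrite ffunE WP // YK.
      by rewrite ffunE; case: (W H) s WH s0 WHs => [[]|] // [[]|].
    apply/exists_inP; exists (compose Z W') => //; rewrite /U ffunE ZH W'H eqxx /=.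
    apply/andP; split; apply/agreeP => K hK; rewrite ffunE.
      by rewrite ZP //; case YK: (Y K) => [b|] //; exact: W'P.
    by rewrite ZO //; case: (C K) (C0 K hK).
  have aT := a_push (Some true) isT; have aF := a_push (Some false) isT.
  case: (a None) aT aF a_elim => [-> // -> //|_ _ a_elim] /=.
    by rewrite mulr1 addKr.
  rewrite mulr0 add0r.
  case: (a (Some true)) (a (Some false)) a_elim => [] [] a_elim;
    by [have := a_elim isT isT | rewrite ?addr0 ?add0r].
move=> /exists_inPn noW.
have no_push s : s != None -> a s = false.
  move=> s0; apply/negbTE/exists_inPn => G GL; apply/negP.
  case/andP => /eqP GH /andP[GP _].
  by have := noW G GL; rewrite GP GH s0.
by rewrite (no_push (Some true)) ?(no_push (Some false)) //= orbF mul1r !addr0.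
Qed.
End EulerCharacteristic.
End SignVectors.

(** * Signed counts of the faces on a wall *)

Section Wall.
Variables (I : finType) (L : {set {ffun I -> option bool}}) (comL : is_com L).
Variables (R : comNzRingType) (e : I).
Local Notation covec := {ffun I -> option bool}.
Implicit Types (X Y Z G C D F : covec) (H K : I) (O P : {set I}).

Definition wall_sign G : R := greedy_sign L R [set e] (rem e (enum I)) G.

(** The greedy order starts with e, so that codimensions are taken inside e. *)
Lemma wall_sign_sum C O :
    {in O, forall H, C H != None} ->
  \sum_(G in L | (G e == None) && agree O G C) wall_sign G
    = [exists G in L, (G e == None) && agree O G C]%:R.
Proof.
pose Y : covec := [ffun=> None].
have agrE G : agree [set e] G Y = (G e == None).
  apply/agreeP/eqP => [->|Ge H /set1P->]; rewrite ?inE ?ffunE //.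
move=> C0.
have := greedy_sign_sum comL R (P := [set e]) (r := rem e (enum I)) Y _ _ C0.
under eq_bigl do rewrite agrE.
under eq_existsb do rewrite agrE.
apply; first by rewrite rem_uniq ?enum_uniq.
by move=> H; rewrite mem_rem_uniq ?enum_uniq // !inE mem_enum andbT.
Qed.

(** The product is expanded one hyperplane at a time: the factor of H is [b H]
plus [1 - b H] times the indicator of G H = C H. The first term leaves the region
unchanged and the second cuts it with a half-space, so by induction they add up
to b H + (1 - b H) as long as the smallest region involved is nonempty. *)
Lemma wall_sign_sum_weighted C O (A : seq I) (b : I -> R) :
    {in O, forall H, C H != None} -> {in A, forall H, C H != None} ->
    (exists2 G, G \in L & [&& G e == None, agree O G C
                            & all (fun H => G H == C H) A]) ->
  \sum_(G in L | (G e == None) && agree O G C)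
     wall_sign G * \prod_(H <- A) (if G H == C H then 1 else b H) = 1.
Proof.
elim: A O => [|H A IH] O C0 CA [G0 G0L /and3P[G0e G0O G0A]].
  under eq_bigr do rewrite big_nil mulr1.
  rewrite wall_sign_sum //; case: exists_inP => // -[].
  by exists G0; rewrite ?G0e.
move: G0A => /= /andP[G0H G0A].
have CA' : {in A, forall H, C H != None}.
  by move=> K KA; apply: CA; rewrite inE KA orbT.
have CH : C H != None by apply: CA; rewrite mem_head.
pose f G := wall_sign G * \prod_(K <- A) (if G K == C K then 1 else b K).
transitivity (b H * \sum_(G in L | (G e == None) && agree O G C) f G
   + (1 - b H) * \sum_(G in L | (G e == None) && agree (H |: O) G C) f G).
  have -> : \sum_(G in L | (G e == None) && agree (H |: O) G C) f G =
      \sum_(G in L | (G e == None) && agree O G C)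
        (if G H == C H then f G else 0).
    rewrite -big_mkcondr; apply: eq_bigl => G.
    by rewrite agreeU1 -!andbA; congr (_ && (_ && _)); rewrite andbC.
  rewrite !mulr_sumr -big_split /=; apply: eq_bigr => G _.
  by rewrite big_cons /f; case: eqP => _; ring.
have CO' : {in H |: O, forall H, C H != None} by move=> K /setU1P[->|/C0].
rewrite (IH O C0 CA') ?(IH (H |: O) CO' CA'); first by ring.
  by exists G0; rewrite // G0e agreeU1 G0H G0O G0A.
by exists G0; rewrite // G0e G0O G0A.
Qed.

(** The condition G H != C H makes the region half-open. A condition in [N] is
the difference of no condition and of G H = C H, so everything reduces to a
region defined by [O] and the single condition on H0, i.e. to the difference of
two Euler characteristics. They are equal: the covector [X], which lies on the
closed C-side of all the hyperplanes and strictly on the C-side of H0, composes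
with any point of the region to give a point of the region with G H0 = C H0. *)
Lemma wall_sign_sum_visible C O (N : seq I) X H0 :
    {in O, forall H, C H != None} -> {in N, forall H, C H != None} ->
    X \in L -> X e = None -> face_le X C -> X H0 != None ->
  \sum_(G in L | [&& G e == None, agree O G C, G H0 != C H0
                   & all (fun H => G H != C H) N]) wall_sign G = 0.
Proof.
move=> + + XL Xe XC XH0.
have XC' H : X H != None -> X H = C H.
  by move/face_leP: XC => /(_ H)[->|].
elim: N O => [|H N IH] O CO CN /=.
  have CO' : {in H0 |: O, forall H, C H != None}.
    by move=> K /setU1P[->|/CO //]; rewrite -XC'.
  have := wall_sign_sum CO; rewrite (bigID (fun G : covec => G H0 == C H0)) /=.
  under [in X in X + _]eq_bigl => G do
    rewrite -!andbA [agree O G C && _]andbC -agreeU1.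
  under [X in _ + X = _]eq_bigl => G do rewrite -!andbA.
  rewrite wall_sign_sum //.
  under [in X in _ -> X = _]eq_bigl => G do rewrite andbT.
  set a := [exists G in L, _]; set a' := [exists G in L, _].
  suff -> : a = a' by move/(canRL (addKr _)) => ->; rewrite addNr.
  apply/exists_inP/exists_inP => -[G GL /andP[Ge]].
    by rewrite agreeU1 => /andP[_ GO]; exists G; rewrite ?Ge.
  move=> GO; exists (compose X G); first exact: (compose_com comL).
  rewrite ffunE Xe Ge /=; apply/agreeP => K.
  rewrite ffunE; case XK: (X K) => [b|]; first by rewrite -XC' ?XK.
  case/setU1P => [K0|KO]; first by rewrite K0 in XK; rewrite XK in XH0.
  by move/agreeP: GO; apply.
have CN' : {in N, forall H, C H != None}.
  by move=> K KA; apply: CN; rewrite inE KA orbT.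
have CH : C H != None by apply: CN; rewrite mem_head.
have := IH O CO CN'; rewrite (bigID (fun G : covec => G H == C H)) /=.
have CO' : {in H |: O, forall H, C H != None} by move=> K /setU1P[->|/CO].
rewrite (_ : \sum_(i | _ && (_ == _)) _ = 0); last first.
  rewrite -[RHS](IH (H |: O) CO' CN'); apply: eq_bigl => G; rewrite agreeU1.
  by do ![case: (_ == _) => //=]; rewrite ?andbF ?andbT.
rewrite add0r => sum0; rewrite -[RHS]sum0; apply: eq_bigl => G.
by do ![case: (_ == _) => //=]; rewrite ?andbF ?andbT.
Qed.
End Wall.

(** * Faces of a chamber on a wall *)

Section Chambers.
Variables (I : finType) (L : {set {ffun I -> option bool}}).
Local Notation covec := {ffun I -> option bool}.
Implicit Types (X Y Z G C D F : covec) (H K e : I).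

Definition wall_faces e C := [set G in L | (G e == None) && face_le G C].

Definition wall_face e F C :=
  (F \in wall_faces e C) && [forall G in wall_faces e C, face_le G F].

(** The number beta_F, computed at the hyperplane [e]. *)
Definition multiplicity F e := #|[set C in topes L | wall_face e F C]|./2.

Lemma wall_facesP e C G :
  reflect [/\ G \in L, G e = None & face_le G C] (G \in wall_faces e C).
Proof.
by rewrite inE; apply: (iffP and3P) => -[GL /eqP ? ?]; split=> //; apply/eqP.
Qed.

Lemma wall_faceP e F C :
  reflect [/\ F \in L, F e = None, face_le F C &
     forall G, G \in L -> G e = None -> face_le G C -> face_le G F]
    (wall_face e F C).
Proof.
apply: (iffP andP) => [[/wall_facesP[FL Fe FC] /forall_inP max]|[FL Fe FC max]].
  by split=> // G GL Ge GC; apply/max/wall_facesP.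
by split; [apply/wall_facesP | apply/forall_inP => G /wall_facesP[]; apply: max].
Qed.

Lemma wall_face_uniq e F F' C : wall_face e F C -> wall_face e F' C -> F = F'.
Proof.
move=> /wall_faceP[FL Fe FC maxF] /wall_faceP[FL' Fe' FC' maxF'].
by apply: face_le_anti; [apply: maxF' | apply: maxF].
Qed.

Section Weights.
Variable R : comNzRingType.
Implicit Types w : I -> bool -> R.

(** The entry v(C, D), for arbitrary weights. *)
Definition distance w C D : R :=
  \prod_(H in separators C D) w H (C H == Some true).

Definition face_weight w F : R := \prod_(H in zeros F) (w H true * w H false).

(** Giving weight 0 to e forbids crossing it. *)
Definition kill e w H b : R := if H == e then 0 else w H b.

(** [wall_coef e C D] is the coefficient of v(C, D) in the matrix that carries
the contribution of e: see [distance_factor]. *)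
Definition wall_coef e C D : R :=
  \sum_(G in L | (G e == None) && (compose G (neg C) == D)) wall_sign L R e G.

End Weights.

Hypothesis comL : is_com L.

Lemma opposite_topes G C :
  G \in L -> C \in topes L -> compose G (neg C) \in topes L.
Proof.
move=> GL /topesP[CL C0]; apply/topesP; split; first exact: face_symmetry.
by move=> H; rewrite !ffunE; case: (G H) => // ; have := C0 H; case: (C H).
Qed.

(** The faces of [C] inside e are closed under composition, so one with the
fewest vanishing signs dominates all the others. *)
Lemma wall_face_exists e C :
  wall_faces e C != set0 -> exists F, wall_face e F C.
Proof.
case/set0Pn => G0 G0C; case: (arg_minnP (fun G => #|zeros G|) G0C) => F FC minF.
have {}FC : F \in wall_faces e C by [].
exists F; rewrite /wall_face FC; apply/forall_inP => G /wall_facesP[GL Ge GC].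
have /wall_facesP[FL Fe FleC] := FC.
have FG_C : compose F G \in wall_faces e C.
  apply/wall_facesP; split; first exact: compose_com.
    by rewrite ffunE Fe Ge.
  move/face_leP: FleC GC => FleC /face_leP GC; apply/face_leP => H.
  by rewrite ffunE; have := FleC H; case: (F H) => [b [] // ->|_]; [right|].
have FG : F = compose F G.
  by apply: face_le_eq (face_le_compose _ _) (minF _ FG_C).
move/face_leP: FleC GC => FleC /face_leP GC; apply/face_leP => H.
rewrite FG ffunE; case: (GC H) => [|->]; first by left.
by right; case: (FleC H) => ->; case: (C H).
Qed.

(** Reflecting C through its largest face F inside e gives a chamber with the
same largest face: for a face Y of the reflected chamber inside e, F o (-Y) is a
face of C inside e, so it cannot leave the flat of F. *)
Lemma wall_face_opposite e F C :
    C \in topes L -> wall_face e F C -> wall_face e F (compose F (neg C)).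
Proof.
move=> /topesP[CL C0] /wall_faceP[FL Fe FC maxF].
apply/wall_faceP; split=> //; first exact: face_le_compose.
move=> Y YL Ye /face_leP YD.
have /face_leP le_F : face_le (compose F (neg Y)) F.
  apply: maxF; first exact: face_symmetry.
    by rewrite !ffunE Fe Ye.
  move/face_leP: FC => FC; apply/face_leP => H; rewrite !ffunE.
  case FH: (F H) => [b|]; first by have := FC H; rewrite FH.
  have := YD H; rewrite !ffunE FH => -[] ->; [by left|right].
  by case: (C H) => [[]|].
apply/face_leP => H; have := YD H; have := le_F H; rewrite !ffunE.
case: (F H) => // ; case: (Y H) => [[]|] [] //; by left.
Qed.

Lemma oppositeK F C : face_le F C -> compose F (neg (compose F (neg C))) = C.
Proof.
move=> /face_leP FC; apply/ffunP => H; rewrite !ffunE; have := FC H.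
by case: (F H) => [b|] []; case: (C H) => [[]|].
Qed.

Lemma separators_opposite F C : C \in topes L -> face_le F C ->
  separators C (compose F (neg C)) = zeros F.
Proof.
move=> /topesP[_ C0] /face_leP FC; apply/setP => H; rewrite !inE !ffunE.
have := FC H; have := C0 H.
by case: (F H) => [[]|] + []; case: (C H) => [[]|].
Qed.
End Chambers.

(** * Factoring out one hyperplane *)

Section Factorisation.
Variables (I : finType) (L : {set {ffun I -> option bool}}) (comL : is_com L).
Variable R : comNzRingType.
Local Notation covec := {ffun I -> option bool}.
Implicit Types (X Y Z G C D F : covec) (H K e : I) (w : I -> bool -> R).

(** Travelling from C to D through the reflection G o (-C) crosses once the
hyperplanes separating C from D, and twice, in opposite directions, the other
ones on which G and C do not have the same sign. On the second leg e is not
crossed, which is why its weight may be killed there. *)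
Lemma distance_via_opposite w e G C D :
    C \in topes L -> D \in topes L -> C e != D e -> G e = None ->
  distance w C (compose G (neg C)) * distance (kill e w) (compose G (neg C)) D
    = distance w C D *
      \prod_(H in ~: separators C D)
         (if G H == C H then 1 else w H true * w H false).
Proof.
move=> /topesP[_ C0] /topesP[_ D0] CDe Ge; rewrite /distance.
rewrite 4!(big_mkcond (fun H => H \in _)) /= -!big_split /=.
apply: eq_bigr => H _; rewrite !inE !ffunE /kill.
have [->|_] := eqVneq H e.
  rewrite Ge; move: CDe (C0 e) (D0 e).
  by case: (C e) => [[]|] //; case: (D e) => [[]|] //=; rewrite ?mulr1.
move: (C0 H) (D0 H).
by case: (C H) => [[]|] //; case: (D H) => [[]|] //; case: (G H) => [[]|] //= _ _;
  rewrite ?mulr1 ?mul1r // mulrC.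
Qed.

(** If some face X of C inside e were off a hyperplane H0 separating C from D,
then the faces counted by the coefficient, those in e with the sign of C on the
hyperplanes that do not separate and any other sign on those that do, would be
a half-open region to which [wall_sign_sum_visible] applies. *)
Lemma wall_coef_ne0 e C D : C \in topes L -> D \in topes L ->
    wall_coef L R e C D != 0 ->
  [/\ D e = omap negb (C e),
      exists2 G, G \in wall_faces L e D & compose G (neg C) = D
    & forall X, X \in wall_faces L e C -> separators C D \subset zeros X].
Proof.
move=> CL DL coef0.
have [G GL /andP[/eqP Ge /eqP GD]] :
    exists2 G, G \in L & (G e == None) && (compose G (neg C) == D).
  apply/exists_inP; apply: contraNT coef0 => /exists_inPn noG.
  by rewrite /wall_coef big_pred0 // => G; apply/negP => /andP[/noG/negbTE->].
split.
- by rewrite -GD !ffunE Ge.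
- exists G => //; apply/wall_facesP; split=> //.
  by rewrite -GD; apply: face_le_compose.
move=> X /wall_facesP[XL Xe XC]; apply/subsetP => H0; rewrite !inE => H0_sep.
apply: contraNT coef0 => XH0.
have [_ C0] := topesP _ _ CL; have [_ D0] := topesP _ _ DL.
have := @wall_sign_sum_visible _ _ comL R e C (~: separators C D)
  (enum (separators C D)) X H0 (fun H _ => C0 H) (fun H _ => C0 H) XL Xe XC XH0.
move=> <-; apply/eqP; apply: eq_bigl => Z; congr (_ && (_ && _)).
apply/eqP/and3P => [ZD|[/agreeP Z_agr ZH0 /allP Z_sep]].
  have notC H : H \in separators C D -> Z H != C H.
    rewrite -ZD !inE !ffunE; have := C0 H.
    by case: (Z H) => [[]|] //; case: (C H) => [[]|].
  split; last by apply/allP => H; rewrite mem_enum => /notC.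
    apply/agreeP => H; rewrite -ZD !inE negbK !ffunE; have := C0 H.
    by case: (Z H) => [[]|] //; case: (C H) => [[]|].
  by apply: notC; rewrite inE.
apply/ffunP => H; rewrite !ffunE.
have [HS|HS] := boolP (H \in separators C D).
  have := Z_sep H; rewrite mem_enum HS => /(_ isT).
  move: HS (C0 H) (D0 H); rewrite inE.
  by case: (Z H) (C H) (D H) => [[]|] [[]|] [[]|].
have := Z_agr H; rewrite inE HS => /(_ isT).
move: HS (C0 H) (D0 H); rewrite inE.
by case: (Z H) (C H) (D H) => [[]|] [[]|] [[]|].
Qed.

Lemma distance_kill_side w e C D :
  C e != D e -> distance (kill e w) C D = 0.
Proof.
move=> CDe; rewrite /distance (bigD1 e) ?inE //=.
by rewrite {1}/kill eqxx mul0r.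
Qed.

Lemma distance_kill_eq w e C D :
  C e = D e -> distance (kill e w) C D = distance w C D.
Proof.
move=> CDe; apply: eq_bigr => H; rewrite inE => CDH.
by rewrite /kill; have [He|//] := eqVneq H e; rewrite He CDe eqxx in CDH.
Qed.

Lemma distance_refl w C : distance w C C = 1.
Proof. by rewrite /distance big_pred0 // => H; rewrite inE eqxx. Qed.

(** When C and D are on the same side of e, no chamber reflected from C is on
the side of D, and only the term D' = C remains. Otherwise grouping the faces G
by D' = G o (-C) turns the sum into v(C, D) times a weighted count of faces, over
a region of e which is nonempty because it meets the segments from C to D. *)
Lemma distance_factor w e C D : C \in topes L -> D \in topes L ->
  distance w C D = \sum_(D' in topes L)
    ((C == D')%:R + distance w C D' * wall_coef L R e C D')
      * distance (kill e w) D' D.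
Proof.
move=> CL DL; under eq_bigr do rewrite mulrDl.
rewrite big_split /= (bigD1 C) //= eqxx mul1r big1 ?addr0; last first.
  by move=> D' /andP[_ /negbTE]; rewrite eq_sym => ->; rewrite mul0r.
have [CDe|CDe] := eqVneq (C e) (D e).
  rewrite distance_kill_eq // big1 ?addr0 // => D' DL'.
  have [->|/(wall_coef_ne0 CL DL')[D'e _ _]] := eqVneq (wall_coef L R e C D') 0.
    by rewrite mulr0 mul0r.
  rewrite distance_kill_side ?mulr0 // D'e -CDe.
  by have [_ /(_ e)] := topesP _ _ CL; case: (C e) => [[]|].
rewrite distance_kill_side // add0r.
pose f D' := distance w C D' * distance (kill e w) D' D.
transitivity (\sum_(G in L | G e == None)
    wall_sign L R e G * f (compose G (neg C))).
  pose A := enum (~: separators C D).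
  pose b H := w H true * w H false.
  have [_ C0] := topesP _ _ CL; have [_ D0] := topesP _ _ DL.
  have no0 G : agree set0 G C by apply/agreeP => H; rewrite inE.
  have sum1 : \sum_(G in L | (G e == None) && agree set0 G C) wall_sign L R e G *
      \prod_(H <- A) (if G H == C H then 1 else b H) = 1.
    apply: wall_sign_sum_weighted; [by []|by move=> H|by move=> H _|].
    have [CL' _] := topesP _ _ CL; have [DL' _] := topesP _ _ DL.
    have [|Z ZL [Ze Zagr]] := elimination comL (H := e) CL' DL' (C0 e).
      by move: CDe (C0 e) (D0 e); case: (C e) (D e) => [[]|] [[]|].
    exists Z => //; rewrite Ze no0 /=; apply/allP => H.
    by rewrite mem_enum !inE negbK => /eqP /Zagr ->.
  rewrite -[LHS]mulr1 -{}sum1 mulr_sumr.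
  apply: eq_big => [G|G /andP[GL /andP[/eqP Ge _]]]; first by rewrite no0 andbT.
  by rewrite /f distance_via_opposite // big_enum /= mulrCA.
rewrite (partition_big (fun G => compose G (neg C)) (mem (topes L))) /=; last first.
  by move=> G /andP[GL _]; apply: opposite_topes.
apply: eq_bigr => D' DL'; rewrite mulrAC -/(f D') /wall_coef mulr_sumr.
apply: eq_big => [G|G /andP[_ /eqP ->]]; first by rewrite andbA.
by rewrite mulrC.
Qed.

(** The two properties that make the factor block triangular with reflections
as the only entries inside a block. *)
Lemma wall_face_coef e C D F F' : C \in topes L -> D \in topes L ->
    wall_face L e F C -> wall_face L e F' D -> wall_coef L R e C D != 0 ->
  face_le F F' /\ (F = F' -> D = compose F (neg C)).
Proof.
move=> CL DL FC F'D coef0.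
have [De [G GD compG] sepF] := wall_coef_ne0 CL DL coef0.
have [_ C0] := topesP _ _ CL; have [_ D0] := topesP _ _ DL.
have {sepF} /subsetP sepF : separators C D \subset zeros F.
  by apply: sepF; case/andP: FC.
have /wall_faceP[FL Fe /face_leP FleC _] := FC.
have F_D H : F H = None \/ F H = C H /\ C H = D H.
  case: (FleC H) => [|FH]; [by left | right; split=> //].
  apply/eqP; apply: contraNT (C0 H) => CDH.
  by have := sepF H; rewrite !inE FH; apply.
split=> [|eqF].
  have /wall_faceP[_ _ _ maxF'] := F'D; apply: maxF' => //.
  by apply/face_leP => H; case: (F_D H) => [|[-> ->]]; [left | right].
have zFG : zeros F \subset zeros G.
  apply: zeros_face_le; rewrite eqF; have /wall_faceP[_ _ _ maxF'] := F'D.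
  by case/wall_facesP: GD => GL Ge GleD; apply: maxF'.
apply/ffunP => H; rewrite !ffunE.
case: (F_D H) => [FH|[FH CD]]; last by rewrite FH CD; case: (D H) (D0 H).
rewrite FH -compG !ffunE.
by have /subsetP/(_ H) := zFG; rewrite !inE FH => /(_ isT) /eqP ->.
Qed.

Lemma wall_coef_none e C D : C \in topes L -> D \in topes L ->
  wall_coef L R e C D != 0 -> exists F, wall_face L e F D.
Proof.
move=> CL DL /(wall_coef_ne0 CL DL)[_ [G GD _] _].
by apply: wall_face_exists => //; apply/set0Pn; exists G.
Qed.

(** F is the only face counted: any other one would be a proper face of F, and
composing it with -C would also flip signs of C on hyperplanes not containing F. *)
Lemma wall_coef_opposite e C F : C \in topes L -> wall_face L e F C ->
  wall_coef L R e C (compose F (neg C)) = wall_sign L R e F.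
Proof.
move=> CL FC; have /wall_faceP[FL Fe FleC _] := FC.
have /wall_faceP[_ _ _ maxF] := wall_face_opposite comL CL FC.
have [_ C0] := topesP _ _ CL.
rewrite /wall_coef (big_pred1 F) // => G.
apply/and3P/eqP => [[GL /eqP Ge /eqP GF]|->]; last by rewrite FL Fe eqxx.
have GleF : face_le G F.
  by apply: maxF => //; rewrite -GF; apply: face_le_compose.
apply: face_le_eq GleF (subset_leq_card _); apply/subsetP => H; rewrite !inE.
have /ffunP/(_ H) := GF; rewrite !ffunE; have := C0 H.
move/face_leP: FleC => /(_ H)[->|->] //.
by case: (G H) (C H) => [[]|] [[]|].
Qed.

Lemma greedy_sign_sqr P r G : greedy_sign L R P r G ^+ 2 = 1.
Proof.
elim: r P => [|H r IH] P /=; first by rewrite expr1n.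
by rewrite exprMn IH mulr1; case: ifP => _; rewrite ?sqrrN expr1n.
Qed.

Lemma distance_opposite w C F : C \in topes L -> face_le F C ->
  distance w C (compose F (neg C)) * distance w (compose F (neg C)) C
    = face_weight w F.
Proof.
move=> CL FC; have [CL' C0] := topesP _ _ CL.
rewrite /distance (separators_opposite CL FC).
have -> : separators (compose F (neg C)) C = zeros F.
  rewrite -(separators_opposite CL FC); apply/setP => H.
  by rewrite !inE eq_sym.
rewrite -big_split; apply: eq_bigr => H; rewrite inE => /eqP FH /=.
rewrite !ffunE FH; move: (C0 H).
by case: (C H) => [[]|] //= _; rewrite mulrC.
Qed.
End Factorisation.

(** * The determinant of the factor *)

(** In the Leibniz formula, a permutation with a nonzero product does not
decrease [rk] anywhere; as it preserves the sum of [rk], it preserves [rk]. *)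
Lemma det_block_triangular (R : comNzRingType) n (M : 'M[R]_n)
    (rk : 'I_n -> nat) :
    (forall i j, (rk j < rk i)%N -> M i j = 0) ->
  \det M = \det (\matrix_(i, j) if rk i == rk j then M i j else 0).
Proof.
move=> M0; rewrite /determinant; apply: eq_bigr => s _; congr (_ * _).
have [/forallP rk_s|] := boolP [forall i, rk i == rk (s i)].
  by apply: eq_bigr => i _; rewrite mxE rk_s.
case/forallPn => i0 i0P.
rewrite [RHS](bigD1 i0) //= mxE (negbTE i0P) mul0r.
have [/exists_inP[i _ lt_i]|/exists_inPn ge_rk] :=
    boolP [exists i in 'I_n, (rk (s i) < rk i)%N].
  by rewrite (bigD1 i) //= M0 ?mul0r.
have le_rk i : (rk i <= rk (s i))%N by rewrite leqNgt ge_rk.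
have := @leqif_sum 'I_n predT (fun i => rk i == rk (s i)) rk (rk \o s)
  (fun i _ => leqif_eq (le_rk i)).
have sum_rk : (\sum_i rk (s i) = \sum_i rk i)%N.
  by rewrite [RHS](reindex_inj (@perm_inj _ s)).
by case=> _; rewrite /= sum_rk eqxx => /esym/forallP/(_ i0); rewrite (negbTE i0P).
Qed.

Section Determinant.
Variables (I : finType) (L : {set {ffun I -> option bool}}) (comL : is_com L).
Variable R : comNzRingType.
Local Notation covec := {ffun I -> option bool}.
Variables (N : nat) (cham : 'I_N -> covec).
Hypothesis cham_inj : injective cham.
Hypothesis cham_topes : [set cham i | i : 'I_N] = topes L.
Implicit Types (X Y Z G C D F : covec) (H K e : I) (w : I -> bool -> R).

Definition distance_mx w : 'M[R]_N :=
  \matrix_(i, j) distance w (cham i) (cham j).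

Lemma chamP i : cham i \in topes L.
Proof. by rewrite -cham_topes imset_f. Qed.

Lemma tope_cham C : C \in topes L -> {i | cham i = C}.
Proof.
rewrite -cham_topes => CL; have [i /eqP|/= no_i] := pickP (fun i => cham i == C).
  by exists i.
by exfalso; case/imsetP: CL => i _ Ci; have := no_i i; rewrite Ci eqxx.
Qed.

Definition wall_mx e w : 'M[R]_N := \matrix_(i, j)
  ((i == j)%:R + distance w (cham i) (cham j) * wall_coef L R e (cham i) (cham j)).

Lemma distance_mx_factor e w :
  distance_mx w = wall_mx e w *m distance_mx (kill e w).
Proof.
apply/matrixP => i j; rewrite !mxE (distance_factor comL w e (chamP i) (chamP j)).
rewrite -cham_topes big_imset /=; last by move=> ? ? _ _; apply: cham_inj.
by apply: eq_big => [k|k _]; rewrite ?inE // !mxE (inj_eq cham_inj).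
Qed.

(** The level grows with the largest face of the chamber inside e; chambers
without any face inside e have level 0. *)
Definition level e i : nat :=
  if [pick F | wall_face L e F (cham i)] is Some F then (#|I| - #|zeros F|).+1
  else 0%N.

Lemma level_wall_face e F i : wall_face L e F (cham i) ->
  level e i = (#|I| - #|zeros F|).+1.
Proof.
rewrite /level => Fi; case: pickP => [G Gi|/(_ F)]; last by rewrite Fi.
by rewrite (wall_face_uniq Fi Gi).
Qed.

Lemma wall_coef_level e i j : wall_coef L R e (cham i) (cham j) != 0 ->
  (level e i <= level e j)%N /\ (level e i = level e j ->
     exists2 F, wall_face L e F (cham i) & cham j = compose F (neg (cham i))).
Proof.
move=> coef0; have [F' F'j] := wall_coef_none comL (chamP i) (chamP j) coef0.
rewrite (level_wall_face F'j) {1 2}/level; case: pickP => [F Fi|_]; last by split.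
have [FF' opp] := wall_face_coef comL (chamP i) (chamP j) Fi F'j coef0.
have le_card : (#|zeros F'| <= #|zeros F|)%N.
  by rewrite subset_leq_card // zeros_face_le.
split=> [|[eq_card]]; first by rewrite ltnS leq_sub2l.
exists F => //; apply/opp/face_le_eq => //.
by rewrite -[leqLHS](subKn (max_card _)) eq_card subKn ?max_card.
Qed.

Lemma wall_coef_side e i j : wall_coef L R e (cham i) (cham j) != 0 ->
  cham j e = omap negb (cham i e).
Proof. by case/(wall_coef_ne0 comL (chamP i) (chamP j)). Qed.

(** The entries of [wall_mx e w] that leave the side [b] of e and stay inside a
diagonal block. *)
Definition crossing_mx e w (b : bool) : 'M[R]_N := \matrix_(i, j)
  if (cham i e == Some b) && (level e i == level e j)
  then distance w (cham i) (cham j) * wall_coef L R e (cham i) (cham j) else 0.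

Lemma crossing_mx_ne0 e w b i j : crossing_mx e w b i j != 0 ->
  [/\ cham i e = Some b, cham j e = Some (~~ b) &
   exists2 F, wall_face L e F (cham i) & cham j = compose F (neg (cham i))].
Proof.
rewrite mxE; case: ifP => [/andP[/eqP ie /eqP lv]|_]; last by rewrite eqxx.
have [->|coef0] := eqVneq (wall_coef L R e (cham i) (cham j)) 0.
  by rewrite mulr0 eqxx.
move=> _; split=> //; first by rewrite (wall_coef_side coef0) ie.
by have [_] := wall_coef_level coef0; apply.
Qed.

Lemma crossing_mx_opposite e w F i j : wall_face L e F (cham i) ->
    cham j = compose F (neg (cham i)) ->
  crossing_mx e w (cham i e == Some true) i j
    = distance w (cham i) (cham j) * wall_sign L R e F.
Proof.
move=> Fi ji; rewrite mxE (level_wall_face Fi).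
have Fj : wall_face L e F (cham j).
  by rewrite ji; apply: wall_face_opposite => //; apply: chamP.
rewrite (level_wall_face Fj) eqxx andbT.
rewrite [in wall_coef _ _ _ _ _]ji wall_coef_opposite ?chamP //.
by have /topesP[_ /(_ e)] := chamP i; case: (cham i e) => [[]|].
Qed.

(** The weight of the round trip from a chamber on the negative side to its
reflection and back. *)
Definition return_weight e w i : R :=
  if (cham i e == Some false) then
    if [pick F | wall_face L e F (cham i)] is Some F then face_weight w F else 0
  else 0.

Lemma crossing_mx_return e w :
  crossing_mx e w false *m crossing_mx e w true
    = diag_mx (\row_i return_weight e w i).
Proof.
set Xp := crossing_mx e w true; set Xm := crossing_mx e w false.
apply/matrixP => i j; rewrite !mxE.
have same k l : Xm i k * Xp k l != 0 -> [/\ l = i, cham i e = Some false &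
    exists2 F, wall_face L e F (cham i) & cham k = compose F (neg (cham i))].
  move=> ne0.
  have /crossing_mx_ne0[ie _ [F Fi ki]] : Xm i k != 0.
    by apply: contraNneq ne0 => ->; rewrite mul0r.
  have /crossing_mx_ne0[_ _ [F' Fk lk]] : Xp k l != 0.
    by apply: contraNneq ne0 => ->; rewrite mulr0.
  split=> //; last by exists F.
  have eqF : F' = F.
    apply: wall_face_uniq Fk _; rewrite ki.
    by apply: wall_face_opposite => //; apply: chamP.
  by apply: cham_inj; rewrite lk ki eqF oppositeK //; case/wall_faceP: Fi.
rewrite /return_weight; have [<-|neq_ij] := eqVneq i j; last first.
  rewrite mulr0n big1 // => k _; apply/eqP; apply: contraNT neq_ij.
  by case/same => ->.
rewrite mulr1n; have [ie|neq_ie] := eqVneq (cham i e) (Some false); last first.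
  rewrite big1 // => k _; apply/eqP; apply: contraT => /same[_ ie _].
  by rewrite ie eqxx in neq_ie.
case: pickP => [F Fi|noF]; last first.
  rewrite big1 // => k _; apply/eqP; apply: contraT => /same[_ _ [F Fi _]].
  by have := noF F; rewrite Fi.
have /wall_faceP[FL Fe FleC _] := Fi.
have [k ki] := tope_cham (opposite_topes comL FL (chamP i)).
rewrite (bigD1 k) //= big1 ?addr0.
  have Fk : wall_face L e F (cham k).
    by rewrite ki; apply: wall_face_opposite => //; apply: chamP.
  have ik : cham i = compose F (neg (cham k)) by rewrite ki oppositeK.
  have := crossing_mx_opposite w Fk ik; have := crossing_mx_opposite w Fi ki.
  have ke : cham k e = Some true by rewrite ki !ffunE Fe ie.
  rewrite ke ie /= -/Xm -/Xp => -> ->.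
  rewrite -(distance_opposite w (chamP i) FleC) -ki mulrACA -expr2.
  by rewrite greedy_sign_sqr mulr1.
move=> k' neq_k; apply/eqP; apply: contraNT neq_k => /same[_ _ [F' F'i k'i]].
by apply/eqP/cham_inj; rewrite ki k'i (wall_face_uniq Fi F'i).
Qed.

(** Up to entries off the diagonal blocks, the matrix is 1 + Xp + Xm, where Xp
and Xm exchange the two sides of e. Multiplying by the unipotent 1 - Xp gives
1 + Xm - Xm Xp, in which Xm is again strictly triangular for the side of e. *)
Lemma det_wall_mx_crossing e w :
  \det (wall_mx e w)
    = \det (1%:M - crossing_mx e w false *m crossing_mx e w true).
Proof.
set Xp := crossing_mx e w true; set Xm := crossing_mx e w false.
transitivity (\det (1%:M + Xp + Xm)).
  rewrite (@det_block_triangular _ _ _ (level e)) => [|i j lt_ji]; last first.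
    rewrite mxE; have [->|/wall_coef_level[le_ij _]] :=
      eqVneq (wall_coef L R e (cham i) (cham j)) 0.
      by rewrite mulr0 addr0; have [ij|//] := eqVneq i j; rewrite ij ltnn in lt_ji.
    by rewrite ltnNge le_ij in lt_ji.
  congr (\det _); apply/matrixP => i j; rewrite !mxE -addrA.
  have /topesP[_ /(_ e) ie] := chamP i.
  have [lv|lv] := eqVneq (level e i) (level e j).
    by rewrite !andbT; case: (cham i e) ie => [[]|] //= _; rewrite ?addr0 ?add0r.
  by rewrite !andbF !addr0; have [ij|//] := eqVneq i j; rewrite ij eqxx in lv.
have XpXp0 : Xp *m Xp = 0.
  apply/matrixP => i j; rewrite !mxE big1 // => k _.
  have [->|/crossing_mx_ne0[_ ke _]] := eqVneq (Xp i k) 0; first by rewrite mul0r.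
  by rewrite [Xp k j]mxE ke mulr0.
have det1Xp : \det (1%:M - Xp) = 1.
  rewrite (@det_block_triangular _ _ _ (fun i => cham i e == Some false : nat)).
    rewrite -[RHS](det1 R N); congr (\det _); apply/matrixP => i j; rewrite !mxE.
    case: ifP => [sd|]; last first.
      by have [->|] := eqVneq i j; rewrite ?eqxx.
    case: ifP => [/andP[/eqP ie lv]|_]; last by rewrite subr0.
    have [->|/wall_coef_side je] := eqVneq (wall_coef L R e (cham i) (cham j)) 0.
      by rewrite mulr0 subr0.
    by rewrite je ie in sd.
  move=> i j lt_ji; rewrite !mxE.
  have [ij|_] := eqVneq i j; first by rewrite ij ltnn in lt_ji.
  by case: ifP => [/andP[/eqP ie _]|_]; [rewrite ie ltn0 in lt_ji | rewrite subr0].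
have := det_mulmx (1%:M + Xp + Xm) (1%:M - Xp); rewrite det1Xp mulr1 => <-.
have -> : (1%:M + Xp + Xm) *m (1%:M - Xp) = 1%:M + Xm - Xm *m Xp.
  rewrite mulmxBr mulmx1 !mulmxDl mul1mx XpXp0 addr0.
  by apply/matrixP => i j; rewrite !mxE; ring.
rewrite /Xm /Xp crossing_mx_return.
rewrite [LHS](@det_block_triangular _ _ _ (fun i => cham i e == Some true : nat)).
  congr (\det _); apply/matrixP => i j; rewrite !mxE.
  case: ifP => [/eqP sd|sd]; last first.
    have [ij|_] := eqVneq i j; last by rewrite !mulr0n subr0.
    by rewrite ij eqxx in sd.
  case: ifP => [/andP[/eqP ie lv]|_]; last by rewrite addr0.
  have [->|/wall_coef_side je] := eqVneq (wall_coef L R e (cham i) (cham j)) 0.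
    by rewrite mulr0 addr0.
  by rewrite je ie in sd.
move=> i j lt_ji; rewrite !mxE.
have [ij|_] := eqVneq i j; first by rewrite ij ltnn in lt_ji.
case: ifP => [/andP[/eqP ie _]|_]; first by rewrite ie ltn0 in lt_ji.
by rewrite !mulr0n addr0 subr0.
Qed.

(** The reflection through F exchanges the two sides of e, so halving the number
of chambers is counting those on one side. *)
Lemma multiplicityE e F : multiplicity L F e =
  #|[set C in topes L | wall_face L e F C & C e == Some false]|.
Proof.
rewrite /multiplicity; set S := [set C in _ | _]; set S' := [set C in _ | _ & _].
pose opp C := compose F (neg C).
have SC C : C \in S -> [/\ C \in topes L, wall_face L e F C,
    face_le F C & F e = None].
  by rewrite inE => /andP[CL FC]; have /wall_faceP[_ ? ? _] := FC.
have oppS C : C \in S -> opp C \in S.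
  case/SC => CL FC _ _; have /wall_faceP[FL _ _ _] := FC.
  by rewrite inE opposite_topes // wall_face_opposite.
have oppK : {in S, cancel opp opp} by move=> C /SC[_ _ ? _]; apply: oppositeK.
have -> : #|S| = (#|S'| + #|opp @: S'|)%N.
  have -> : S = S' :|: opp @: S'.
    apply/setP => C; apply/idP/setUP => [CS|[|/imsetP[D DS' ->]]].
    - have [CL FC _ Fe] := SC _ CS; have /topesP[_ /(_ e) Ce] := CL.
      have [Cf|Cf] := eqVneq (C e) (Some false); [left | right].
        by rewrite inE CL FC Cf eqxx.
      apply/imsetP; exists (opp C); last by rewrite oppK.
      have := oppS _ CS; rewrite !inE => /andP[-> ->].
      by rewrite !ffunE Fe; case: (C e) Ce Cf => [[]|].
    - by rewrite !inE => /and3P[-> ->].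
    - by apply: oppS; move: DS'; rewrite !inE => /and3P[-> ->].
  rewrite cardsU disjoint_setI0 ?cards0 ?subn0 //.
  rewrite disjoints_subset; apply/subsetP => C; rewrite !inE => /and3P[_ _ /eqP Cf].
  apply/imsetP => -[D]; rewrite inE => /and3P[DL FD /eqP Df] CD; move: Cf.
  by rewrite CD !ffunE; have /wall_faceP[_ -> _ _] := FD; rewrite Df.
rewrite card_in_imset ?addnn ?doubleK // => C D CS' DS'.
apply: (can_in_inj oppK).
  by move: CS'; rewrite !inE => /and3P[-> ->].
by move: DS'; rewrite !inE => /and3P[-> ->].
Qed.

Lemma det_wall_mx e w : \det (wall_mx e w) =
  \prod_(F in L | F e == None) (1 - face_weight w F) ^+ multiplicity L F e.
Proof.
rewrite det_wall_mx_crossing crossing_mx_return.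
have -> : 1%:M - diag_mx (\row_i return_weight e w i)
    = diag_mx (\row_i (1 - return_weight e w i)).
  by apply/matrixP => i j; rewrite !mxE mulrnBl.
rewrite det_diag; under eq_bigr do rewrite mxE.
transitivity (\prod_i \prod_(F in L | F e == None)
    if (cham i e == Some false) && wall_face L e F (cham i)
    then 1 - face_weight w F else 1).
  apply: eq_bigr => i _; rewrite /return_weight.
  case: eqP => _ /=; last by rewrite subr0 big1.
  case: pickP => [F Fi|noF]; last first.
    by rewrite subr0 big1 // => F _; rewrite noF.
  have /wall_faceP[FL Fe _ _] := Fi.
  rewrite (bigD1 F) ?FL ?Fe //= Fi big1 ?mulr1 // => G /andP[_ neq_GF].
  by case: ifP => // Gi; rewrite (wall_face_uniq Fi Gi) eqxx in neq_GF.
rewrite exchange_big /=; apply: eq_bigr => F _.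
rewrite -big_mkcond prodr_const multiplicityE; congr (_ ^+ _).
rewrite -(card_imset _ cham_inj); apply: eq_card => C; rewrite inE.
apply/imsetP/and3P => [[i /andP[ie Fi] ->]|[CL FC Ce]].
  by split; rewrite ?chamP.
have [i iC] := tope_cham CL; exists i => //.
by rewrite unfold_in iC Ce FC.
Qed.

Lemma det_distance_mx_kill e w : \det (distance_mx w) =
  (\prod_(F in L | F e == None) (1 - face_weight w F) ^+ multiplicity L F e)
    * \det (distance_mx (kill e w)).
Proof. by rewrite {1}(distance_mx_factor e) det_mulmx det_wall_mx. Qed.
End Determinant.

(** * Iterating over the hyperplanes *)

Section Iteration.
Variables (I : finType) (L : {set {ffun I -> option bool}}) (comL : is_com L).
Local Notation covec := {ffun I -> option bool}.
Variables (N : nat) (cham : 'I_N -> covec).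
Hypothesis cham_inj : injective cham.
Hypothesis cham_topes : [set cham i | i : 'I_N] = topes L.
Implicit Types (X Y Z G C D F : covec) (H K e : I) (S : {set I}).

Definition weights_on (R : comNzRingType) (w : I -> bool -> R) S H b : R :=
  if H \in S then w H b else 0.

Definition mult_along (l : seq I) G : nat :=
  if [seq H <- l | G H == None] is H :: _ then multiplicity L G H else 0.

Lemma eq_distance_mx (R : comNzRingType) (w w' : I -> bool -> R) :
  w =2 w' -> distance_mx cham w = distance_mx cham w'.
Proof.
move=> ww'; apply/matrixP => i j; rewrite !mxE.
by apply: eq_bigr => H _; apply: ww'.
Qed.

Lemma face_weight_on (R : comNzRingType) (w : I -> bool -> R) S G :
  zeros G != set0 ->
  face_weight (weights_on w S) G = if zeros G \subset S then face_weight w G else 0.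
Proof.
move=> G0; case: ifP => [/subsetP GS|/negbT/subsetPn[H HG HS]].
  by apply: eq_bigr => H /GS HS; rewrite /weights_on HS.
by rewrite /face_weight (bigD1 H) //= /weights_on (negbTE HS) !mul0r.
Qed.

(** The hyperplanes of [l] are killed in order. When e is, the faces inside e
contribute, except those contained in a hyperplane outside [l] or killed before,
whose weight is already 0. Once all the weights are 0 the matrix is the identity. *)
Lemma det_distance_mx_on (R : comNzRingType) (w : I -> bool -> R) (l : seq I) :
    uniq l ->
  \det (distance_mx cham (weights_on w [set H in l])) =
    \prod_(G in L | (zeros G != set0) && (zeros G \subset [set H in l]))
      (1 - face_weight w G) ^+ mult_along l G.
Proof.
elim: l => [_|e l IH /= /andP[el ul]].
  rewrite [RHS]big_pred0 => [|G]; last first.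
    have -> : [set H in [::] : seq I] = set0 by apply/setP => H; rewrite !inE.
    by rewrite subset0; case: eqP; rewrite ?andbF.
  rewrite -[RHS](det1 R N); congr (\det _); apply/matrixP => i j; rewrite !mxE.
  have [->|neq_ij] := eqVneq i j; first by rewrite distance_refl.
  have [H ijH] : exists H, cham i H != cham j H.
    apply/existsP; apply: contraNT neq_ij => /existsPn same.
    by apply/eqP/cham_inj/ffunP => H; apply/eqP/negbNE/same.
  by rewrite /distance (bigD1 H) ?inE //= /weights_on !inE mul0r.
rewrite (det_distance_mx_kill comL cham_inj cham_topes e).
have -> : distance_mx cham (kill e (weights_on w [set H in e :: l]))
    = distance_mx cham (weights_on w [set H in l]).
  apply: eq_distance_mx => H b; rewrite /kill /weights_on !inE.
  by have [->|_] := eqVneq H e; rewrite ?(negbTE el).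
rewrite {}IH //= [RHS](bigID (fun G : covec => G e == None)) /=; congr (_ * _).
  rewrite (bigID (fun G : covec => zeros G \subset [set H in e :: l])) /=.
  rewrite [X in _ * X]big1 ?mulr1.
    apply: eq_big => [G|G /andP[/andP[GL Ge] Gl]].
      case: (G \in L) => //=; case: eqP => //= [Ge|_]; last by rewrite !andbF.
      rewrite andbT; case: set0Pn => //= -[]; exists e; by rewrite inE Ge.
    have G0 : zeros G != set0 by apply/set0Pn; exists e; rewrite inE.
    by rewrite face_weight_on // Gl /mult_along /= Ge.
  move=> G /andP[/andP[GL Ge] Gl].
  have G0 : zeros G != set0 by apply/set0Pn; exists e; rewrite inE.
  by rewrite face_weight_on // (negbTE Gl) subr0 expr1n.
apply: eq_big => [G|G /andP[GL /andP[_ Gl]]]; last first.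
  rewrite /mult_along /=; case: ifP => // Ge.
  by have := subsetP Gl e; rewrite !inE Ge (negbTE el) => /(_ isT).
rewrite -!andbA; congr (_ && (_ && _)).
apply/subsetP/andP => [Gl|[/subsetP Gl Ge] H HG].
  split; first by apply/subsetP => H /Gl; rewrite !inE orbC => ->.
  by apply/negP => Ge; have := Gl e; rewrite !inE Ge (negbTE el) => /(_ isT).
have := Gl H HG; rewrite !inE => /orP[/eqP He|//].
by move: HG; rewrite inE He (negbTE Ge).
Qed.

Lemma mult_along_zeros l G : (exists2 e, e \in l & e \in zeros G) ->
  exists2 e, e \in zeros G & mult_along l G = multiplicity L G e.
Proof.
move=> [e el eG]; rewrite /mult_along.
case E : [seq H <- l | _] => [|H s].
  have : e \in [seq H <- l | G H == None].
    by rewrite mem_filter el andbT; rewrite inE in eG.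
  by rewrite E.
by exists H => //; have := mem_head H s; rewrite -E mem_filter inE => /andP[].
Qed.

(** C |-> G o C sends the chambers around F bijectively to the chambers around G,
with inverse composition with F, and keeps their signs on the hyperplanes through
both. *)
Lemma multiplicity_local F G e : F \in L -> G \in L -> zeros F = zeros G ->
  multiplicity L F e = multiplicity L G e.
Proof.
suff le_card F' G' : F' \in L -> G' \in L -> zeros F' = zeros G' ->
    (#|[set C in topes L | wall_face L e F' C]|
      <= #|[set C in topes L | wall_face L e G' C]|)%N.
  move=> FL GL FG; congr (_ ./2); apply/eqP.
  by rewrite eqn_leq !le_card.
move=> FL GL FG.
have FG0 H : (F' H == None) = (G' H == None).
  by have /setP/(_ H) := FG; rewrite !inE.
set SF := [set C in _ | _]; rewrite -(@card_in_imset _ _ (compose G')).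
  apply/subset_leq_card/subsetP => _ /imsetP[C CF ->].
  have {CF} /andP[CL FC] : (C \in topes L) && wall_face L e F' C.
    by move: CF; rewrite inE.
  have [CL' C0] := topesP _ _ CL.
  have /wall_faceP[_ Fe /face_leP FleC maxF] := FC.
  rewrite inE; apply/andP; split.
    apply/topesP; split=> [|H]; first exact: compose_com.
    by rewrite ffunE; case: (G' H).
  apply/wall_faceP; split=> //.
  - by apply/eqP; rewrite -FG0 Fe.
  - exact: face_le_compose.
  move=> Y YL Ye /face_leP YGC.
  have /face_leP FY : face_le (compose F' Y) F'.
    apply: maxF; first exact: compose_com.
      by rewrite ffunE Fe Ye.
    apply/face_leP => H; rewrite ffunE; have := FleC H; have := YGC H.
    by rewrite ffunE; have := FG0 H; case: (F' H) (G' H) => [a|] [b|].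
  apply/face_leP => H; have := YGC H; have := FY H; rewrite !ffunE.
  by have := FG0 H; case: (F' H) (G' H) => [a|] [b|].
move=> C D; rewrite !inE => /andP[_ /wall_faceP[_ _ /face_leP FC _]].
move=> /andP[_ /wall_faceP[_ _ /face_leP FD _]] /ffunP CD.
apply/ffunP => H; have := FC H; have := FD H; have := CD H; rewrite !ffunE.
have := FG0 H; case: (F' H) (G' H) => [a|] [b|] //= _ _.
by case=> // <- [] // <-.
Qed.

(** Both e and e' can be put first in an order on the hyperplanes through F. The
determinant does not depend on this order, and by induction neither do the
contributions [P] of the faces contained in fewer hyperplanes than F. With
weight 2 on these hyperplanes and 0 elsewhere, what remains is a power of
1 - 4^k, of absolute value greater than 1, so the exponent can be read off. *)
Lemma multiplicity_indep F e e' : F \in L -> e \in zeros F -> e' \in zeros F ->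
  multiplicity L F e = multiplicity L F e'.
Proof.
have [k] := ubnP #|zeros F|; elim: k F e e' => // k IH F e e' ltk FL eF eF'.
set S := zeros F; pose w := fun (_ : I) (_ : bool) => 2%:R : int.
pose x : int := 1 - face_weight w F.
pose proper G := [&& G \in L, zeros G != set0, zeros G \subset S & zeros G != S].
pose flat G := (G \in L) && (zeros G == S).
pose list_from a := a :: enum (S :\ a).
have mem_from a : a \in S -> [set H in list_from a] = S.
  move=> aS; apply/setP => H; rewrite in_set in_cons mem_enum in_setD1.
  by have [->|] := eqVneq H a; rewrite ?aS.
pose P a :=
  \prod_(G | proper G) (1 - face_weight w G) ^+ mult_along (list_from a) G.
have w_expand G : 1 - face_weight w G = 1 - 4 ^+ #|zeros G|.
  by rewrite /face_weight prodr_const.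
have xneq G : zeros G != set0 -> (1 < `|1 - face_weight w G| :> int).
  rewrite w_expand -card_gt0 => G0; rewrite distrC ger0_norm; last first.
    by rewrite subr_ge0 exprn_ege1.
  rewrite ltrBrDr; apply: lt_le_trans (_ : 4 ^+ 1 <= _) => //.
  by rewrite ler_weXn2l.
have P0 a : P a != 0.
  apply/prodf_neq0 => G /and4P[_ G0 _ _]; rewrite expf_neq0 // -normr_gt0.
  by apply: lt_trans (xneq G G0).
have det_from a : a \in S -> \det (distance_mx cham (weights_on w S))
    = (x ^+ multiplicity L F a) ^+ #|[pred G | flat G]| * P a.
  move=> aS; have := det_distance_mx_on w (l := list_from a).
  rewrite mem_from // => ->; last first.
    by rewrite /= mem_enum !inE eqxx enum_uniq.
  rewrite (bigID (fun G : covec => zeros G == S)) /=; congr (_ * _).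
    rewrite -prodr_const; apply: eq_big => [G|G /andP[/and3P[GL _ _] /eqP GS]].
      rewrite inE /flat; have [->|_] := eqVneq (zeros G) S; rewrite ?andbF //.
      by rewrite subxx !andbT andb_idr // => _; apply/set0Pn; exists a.
    rewrite /x !w_expand GS; congr (_ ^+ _).
    have : G a = None by apply/eqP; move: aS; rewrite -GS inE.
    rewrite /mult_along /= => ->; rewrite eqxx.
    exact: multiplicity_local.
  by apply: eq_bigl => G; rewrite /proper -!andbA.
have PE : P e = P e'.
  apply: eq_bigr => G /and4P[GL /set0Pn[H HG] GS G_neq]; congr (_ ^+ _).
  have [a aG ->] : exists2 a, a \in zeros G &
      mult_along (list_from e) G = multiplicity L G a.
    apply: mult_along_zeros; exists H => //.
    by have := subsetP GS H HG; rewrite -(mem_from e) // inE.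
  have [a' aG' ->] : exists2 a, a \in zeros G &
      mult_along (list_from e') G = multiplicity L G a.
    apply: mult_along_zeros; exists H => //.
    by have := subsetP GS H HG; rewrite -(mem_from e') // inE.
  apply: IH => //; rewrite -ltnS; apply: leq_trans ltk; rewrite ltnS.
  by rewrite proper_card // properEneq G_neq.
have := det_from e eF; rewrite (det_from e' eF') PE => /(mulIf (P0 e')).
rewrite -!exprM => /(congr1 (fun y : int => `|y|)); rewrite !normrX.
have F0 : zeros F != set0 by apply/set0Pn; exists e.
have x1 := xneq F F0; move/ieexprIn => /(_ (lt_trans ltr01 x1)).
rewrite (gt_eqF x1) => /(_ isT) /eqP; rewrite eqn_pmul2r ?[X in _ -> X]eq_sym.
  by move/eqP.
by apply/card_gt0P; exists F; rewrite inE /flat FL eqxx.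
Qed.

(** Varchenko's formula for the topes of a conditional oriented matroid, with
weights in any commutative ring. *)
Theorem det_distance_mx (R : comNzRingType) (w : I -> bool -> R)
    (b : covec -> nat) :
    (forall G, G \in L -> zeros G != set0 ->
       exists2 e, e \in zeros G & b G = multiplicity L G e) ->
  \det (distance_mx cham w)
    = \prod_(G in L | zeros G != set0) (1 - face_weight w G) ^+ b G.
Proof.
move=> bP; have memT : [set H in enum I] = setT.
  by apply/setP => H; rewrite !inE mem_enum.
have := det_distance_mx_on w (enum_uniq I); rewrite memT.
rewrite (@eq_distance_mx _ _ w) => [->|H c]; last by rewrite /weights_on inE.
apply: eq_big => [G|G /and3P[GL G0 _]]; first by rewrite subsetT andbT.
have [e eG ->] := bP G GL G0; congr (_ ^+ _).
have [a aG ->] : exists2 a, a \in zeros G &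
    mult_along (enum I) G = multiplicity L G a.
  by apply: mult_along_zeros; exists e; rewrite // mem_enum.
exact: multiplicity_indep.
Qed.
End Iteration.

(** * Geometry of the faces of an arrangement *)

Section Geometry.
Variables (R : realType) (n : nat) (I : finType) (A : arrangement R n I).
Local Notation covec := {ffun I -> option bool}.
Implicit Types (x y z : 'rV[R]_n) (H : I) (X Y C F : covec).

Definition height H x : R := affine_form (normal A H) (offset A H) x.

Definition sign_of (r : R) : option bool := if r == 0 then None else Some (0 < r).

Definition sign_vector x : covec := [ffun H => sign_of (height H x)].

Definition covectors : {set covec} := [set X | `[< cell A X !=set0 >]%classic].

Lemma partE H e x : part A H e x <-> sign_of (height H x) = e.
Proof.
rewrite /part /sign_of -/(height H x).
case: e => [[]|] /=; case: (ltgtP 0 (height H x)) => x0; split=> // fx0.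
  by rewrite /height fx0 ltxx in x0.
by rewrite /height fx0 ltxx in x0.
Qed.

Lemma cellE X x : cell A X x <-> sign_vector x = X.
Proof.
split=> [Xx|<- H _]; last by apply/partE; rewrite ffunE.
by apply/ffunP => H; rewrite ffunE; apply/partE/Xx.
Qed.

Lemma covectorsP X : reflect (exists x, sign_vector x = X) (X \in covectors).
Proof.
rewrite inE; apply: (iffP (asboolP _)) => [[x /cellE]|[x Xx]]; first by exists x.
by exists x; apply/cellE.
Qed.

Lemma sign_vector_cov x : sign_vector x \in covectors.
Proof. by apply/covectorsP; exists x. Qed.

Lemma height_line H x y (t : R) :
  height H (x + t *: (y - x)) = height H x + t * (height H y - height H x).
Proof.
rewrite /height /affine_form.
have -> : \sum_(j < n) normal A H 0 j * (x + t *: (y - x)) 0 j =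
   \sum_(j < n) normal A H 0 j * x 0 j +
   t * (\sum_(j < n) normal A H 0 j * y 0 j - \sum_(j < n) normal A H 0 j * x 0 j).
  rewrite -sumrB mulr_sumr -big_split; apply: eq_bigr => j _ /=.
  by rewrite !mxE; ring.
ring.
Qed.

(** One step length that is too short to cross any of the finitely many
hyperplanes not containing x. *)
Lemma small_step x y : exists2 t : R, 0 < t &
  forall H, height H x != 0 -> t * `|height H y - height H x| < `|height H x|.
Proof.
pose c H := `|height H y - height H x| / `|height H x|.
have c0 H : 0 <= c H by rewrite divr_ge0.
pose s := 1 + \sum_H c H.
have s0 : 0 < s by rewrite ltr_pwDl // sumr_ge0.
(* s exceeds every ratio c H. *)
exists s^-1 => [|H xH]; first by rewrite invr_gt0.
rewrite mulrC ltr_pdivrMr // mulrC -ltr_pdivrMr ?normr_gt0 //.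
rewrite -/(c H) /s (bigD1 H) //=.
have : 0 <= \sum_(i | i != H) c i by rewrite sumr_ge0.
lra.
Qed.

Lemma sign_of_opp (r : R) : sign_of (- r) = omap negb (sign_of r).
Proof. by rewrite /sign_of oppr_eq0 oppr_gt0; case: (ltgtP r 0). Qed.

Lemma sign_of_pos (t r : R) : 0 < t -> sign_of (t * r) = sign_of r.
Proof. by move=> t0; rewrite /sign_of mulf_eq0 gt_eqF //= pmulr_rgt0. Qed.

Lemma sign_of_close (r s : R) : `|s| < `|r| -> sign_of (r + s) = sign_of r.
Proof.
rewrite /sign_of; case: (ltgtP r 0) => [r0|r0|->]; rewrite ?normr0 ?normr_lt0 //.
  rewrite (ltr0_norm r0) => /(le_lt_trans (ler_norm s)) s_lt.
  have z0 : r + s < 0 by rewrite -ltrBrDl sub0r.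
  by rewrite lt_eqF // lt_gtF.
rewrite (gtr0_norm r0) => s_lt.
have z0 : 0 < r + s.
  by rewrite addrC -ltrBlDr sub0r ltrNl (le_lt_trans (ler_norm _)) // normrN.
by rewrite gt_eqF // z0.
Qed.

Lemma sign_of_convex (r s t : R) : 0 < t -> t < 1 -> sign_of r = sign_of s ->
  sign_of (r + t * (s - r)) = sign_of r.
Proof.
move=> t0 t1; have -> : r + t * (s - r) = (1 - t) * r + t * s by ring.
have t1' : 0 < 1 - t by rewrite subr_gt0.
rewrite /sign_of; case: (ltgtP 0 r) => r0; case: (ltgtP 0 s) => s0 //= _.
- have z0 : 0 < (1 - t) * r + t * s by rewrite addr_gt0 // mulr_gt0.
  by rewrite gt_eqF // z0.
- have z0 : (1 - t) * r + t * s < 0.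
    by rewrite -oppr_gt0 opprD -!mulrN addr_gt0 // mulr_gt0 ?oppr_gt0.
  by rewrite lt_eqF // lt_gtF.
- by rewrite -r0 -s0 !mulr0 addr0 eqxx.
Qed.

(** Face symmetry comes from a short step from x away from y, elimination from
the point where the segment from x to y crosses H. *)
Lemma covectors_com : is_com covectors.
Proof.
split.
  move=> _ _ /covectorsP[x <-] /covectorsP[y <-]; apply/covectorsP.
  have [t t0 t_small] := small_step x y.
  exists (x + (- t) *: (y - x)); apply/ffunP => H; rewrite !ffunE height_line.
  have [x0|x0] := eqVneq (height H x) 0.
    rewrite {2}/sign_of x0 eqxx add0r subr0 mulNr sign_of_opp.
    by rewrite sign_of_pos.
  rewrite sign_of_close; last first.
    by rewrite normrM normrN (gtr0_norm t0) t_small.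
  by rewrite /sign_of (negbTE x0).
move=> _ _ H /covectorsP[x <-] /covectorsP[y <-]; rewrite !ffunE => xH yH.
pose t := height H x / (height H x - height H y).
have [t0 t1 tH] :
    [/\ 0 < t, t < 1 & height H x + t * (height H y - height H x) = 0].
  move: xH yH; rewrite /sign_of /t.
  case: (ltgtP 0 (height H x)) => //= x0 _; case: (ltgtP 0 (height H y)) => //= y0 _.
    have xy : 0 < height H x - height H y by lra.
    by split; [rewrite divr_gt0 | rewrite ltr_pdivrMr //; lra | field; lra].
  have xy : height H x - height H y < 0 by lra.
  split; last by field; lra.
    by rewrite -mulrNN -invrN divr_gt0 //; lra.
  by rewrite -mulrNN -invrN ltr_pdivrMr; lra.
exists (sign_vector (x + t *: (y - x))); first exact: sign_vector_cov.
split=> [|K]; rewrite !ffunE height_line; first by rewrite tH /sign_of eqxx.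
exact: sign_of_convex.
Qed.

Lemma height_continuous H : continuous (height H).
Proof.
have term_cont j : continuous (fun x : 'rV[R]_n => normal A H 0 j * x 0 j).
  by move=> x; apply: continuousM; [exact: cst_continuous | exact: coord_continuous].
have sum_cont : continuous (fun x : 'rV[R]_n => \sum_(j < n) normal A H 0 j * x 0 j).
  by apply: continuous_big => [|j _]; [exact: add_continuous | exact: term_cont].
by move=> x; apply: continuousB; [exact: sum_cont | exact: cst_continuous].
Qed.

(** The closure of a cell is obtained by making its inequalities weak: a point
satisfying the weak ones is the limit of the segment joining it to the cell. *)
Lemma closure_cell C : C \in covectors ->
  closure (cell A C) = [set x | face_le (sign_vector x) C]%classic.
Proof.
move=> /covectorsP[c cC]; apply/seteqP; split=> x /=; last first.
  move=> /face_leP xC B Bx.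
  pose g (t : R) := x + t *: (c - x).
  have g0 : (g t @[t --> (0 : R)^'+] --> x)%classic.
    have gx : g 0 = x by rewrite /g scale0r addr0.
    rewrite -[X in (_ --> X)%classic]gx; apply: cvg_at_right_filter.
    have g_cont : {for 0, continuous g}.
      have := @continuousD R _ _ (fun=> x) (fun t : R => t *: (c - x)) 0.
      by apply; [exact: cst_continuous | exact: scalel_continuous].
    exact: g_cont.
  have Bg : (\forall t \near (0 : R)^'+, B (g t))%classic by apply: g0.
  near (0 : R)^'+%classic => t.
  have t0 : 0 < t by near: t; apply: nbhs_right_gt.
  have t1 : t < 1 by near: t; apply: nbhs_right_lt.
  exists (g t); split; last by near: t.
  apply/cellE/ffunP => H; rewrite ffunE height_line -cC ffunE.
  have := xC H; rewrite -cC !ffunE => -[x0|xc]; last first.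
    by rewrite sign_of_convex.
  have -> : height H x = 0 by move: x0; rewrite /sign_of; case: eqP.
  by rewrite add0r subr0 sign_of_pos.
move=> xC; apply/face_leP => H; rewrite ffunE.
have xD (D : set R) : closed D -> (forall y, cell A C y -> D (height H y)) ->
    D (height H x).
  move=> clD CD; move: xC; rewrite closureE.
  move=> /(_ (height H @^-1` D)%classic); apply; split=> //.
  by apply: preimage_closed => // y _; apply: height_continuous.
have := xD [set r | sign_of r = None \/ sign_of r = C H]%classic; apply.
  rewrite /sign_of; case: (C H) => [[]|].
  - rewrite [X in closed X](_ : _ = [set r | 0 <= r]%classic); first exact: closed_ge.
    apply/seteqP; split=> r /=; case: (ltgtP 0 r) => //= r0 hr;
      by [left | right | case: hr].
  - rewrite [X in closed X](_ : _ = [set r | r <= 0]%classic); first exact: closed_le.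
    apply/seteqP; split=> r /=; case: (ltgtP 0 r) => //= r0 hr;
      by [left | right | case: hr].
  - rewrite [X in closed X](_ : _ = [set r | r = 0]%classic); first exact: closed_eq.
    apply/seteqP; split=> r /=; first by case: (eqVneq r 0) => // _ [].
    by move=> ->; rewrite eqxx; left.
by move=> y /cellE <-; right; rewrite ffunE.
Unshelve. all: by end_near.
Qed.

Lemma face_covector (F : face A) : val F \in covectors.
Proof. by rewrite inE; exact: (valP F). Qed.

Lemma covector_face X : X \in covectors -> {F : face A | val F = X}.
Proof. by rewrite inE => h; exists (Sub X h : face A). Qed.

Lemma chambersE (F : face A) : (F \in chambers A) = (zeros (val F) == set0).
Proof.
rewrite inE; apply/forallP/eqP => [F0|F0 H].
  by apply/setP => H; rewrite !inE; apply/negbTE/F0.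
by have /setP/(_ H) := F0; rewrite !inE /epsilon => ->.
Qed.

Lemma chamber_topes (F : face A) :
  (F \in chambers A) = (val F \in topes covectors).
Proof. by rewrite chambersE [RHS]inE face_covector. Qed.

Lemma localizationE (F : face A) : localization F = zeros (val F).
Proof.
apply/setP => H; rewrite !inE; apply/asboolP/eqP => [FH|FH x /cellE xF].
  have /covectorsP[x xF] := face_covector F.
  have /FH/partE : face_set F x by apply/cellE.
  by rewrite -xF ffunE.
by apply/partE; rewrite -FH -xF ffunE.
Qed.

Lemma closure_face (F : face A) :
  closure (face_set F) = [set x | face_le (sign_vector x) (val F)]%classic.
Proof. exact/closure_cell/face_covector. Qed.

(** Closures of cells being unions of faces, the closure of C meets H in the
closure of F exactly when F is the largest face of C inside H. *)
Lemma chambers_atE (F C : face A) H : H \in localization F ->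
  (C \in chambers_at F H)
    = (val C \in topes covectors) && wall_face covectors H (val F) (val C).
Proof.
rewrite localizationE inE => /eqP FH; rewrite [LHS]inE chamber_topes; congr (_ && _).
rewrite !closure_face; apply/asboolP/wall_faceP => [/seteqP[sub1 sub2]|].
  have in_hyp x : face_le (sign_vector x) (val C) -> sign_vector x H = None ->
      face_le (sign_vector x) (val F).
    by move=> xC xH; apply: sub1; split=> //; apply/partE; rewrite ffunE in xH.
  split=> //; first exact: face_covector.
    have /covectorsP[x xF] := face_covector F.
    by have [|+ _] := sub2 x; rewrite /= xF // face_le_refl.
  by move=> G /covectorsP[x <-] xH xC; apply: in_hyp.
move=> [_ _ FC maxF]; apply/seteqP; split=> x /=.
  move=> [xC /partE xH]; apply: maxF => //; first exact: sign_vector_cov.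
  by rewrite ffunE.
move=> xF; split; first exact: face_le_trans xF FC.
by apply/partE; move/face_leP: xF => /(_ H); rewrite ffunE FH => -[].
Qed.

Lemma card_chambers_at (F : face A) H : H \in localization F ->
  #|chambers_at F H|./2 = multiplicity covectors (val F) H.
Proof.
move=> FH; congr (_ ./2); rewrite -(card_imset _ val_inj); apply: eq_card => C.
rewrite inE; apply/imsetP/andP => [[D + ->]|[CL FC]].
  by rewrite chambers_atE // => /andP.
have [D DC] : {D : face A | val D = C}.
  by apply: covector_face; case/topesP: CL.
by exists D; rewrite // chambers_atE // DC CL FC.
Qed.

Lemma vE (C D : face A) : C \in chambers A -> D \in chambers A ->
  v C D = distance (@h I) (val C) (val D).
Proof.
rewrite !chamber_topes => /topesP[_ C0] /topesP[_ D0]; rewrite /v.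
case: eqP => [->|_]; first by rewrite distance_refl.
pose side H := (H, val C H == Some true).
have -> : separating C D = side @: separators (val C) (val D).
  apply/setP => -[H b]; rewrite inE /= /epsilon; apply/andP/imsetP.
    case=> /eqP CH /eqP DH; exists H; first by rewrite inE CH DH; case: (b).
    by rewrite /side CH; case: (b).
  case=> K; rewrite inE => CD [-> ->]; move: CD (C0 K) (D0 K).
  by case: (val C K) (val D K) => [[]|] [[]|].
by rewrite big_imset //= => H K _ _ [].
Qed.

Lemma weightE (F : face A) : weight F = face_weight (@h I) (val F).
Proof. by rewrite /weight localizationE. Qed.
End Geometry.

Theorem corollary1p4 (R : realType) (n : nat) (I : finType)
    (A : arrangement R n I) (beta : face A -> nat)
    (hbeta : forall F : face A, F \notin chambers A ->
       is_multiplicity F (beta F)) :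
  \det (varchenko_matrix A) =
    \prod_(F : face A | F \notin chambers A) (1 - weight F) ^+ beta F.
Proof.
pose cham (i : 'I_#|chambers A|) : {ffun I -> option bool} := val (enum_val i).
have cham_inj : injective cham.
  by move=> i j /val_inj /enum_val_inj.
have cham_topes : [set cham i | i : _] = topes (covectors A).
  apply/setP => C; apply/imsetP/idP => [[i _ ->]|CL].
    by rewrite -chamber_topes enum_valP.
  have [F FC] : {F : face A | val F = C}.
    by apply: covector_face; case/topesP: CL.
  have Fc : F \in chambers A by rewrite chamber_topes FC.
  by exists (enum_rank_in Fc F); rewrite // /cham enum_rankK_in.
have -> : varchenko_matrix A = (distance_mx cham (@h I))^T.
  by apply/matrixP => i j; rewrite !mxE vE ?enum_valP.
pose b X := if insub X is Some F then beta F else 0%N.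
rewrite det_tr (det_distance_mx (covectors_com A) cham_inj cham_topes _ (b := b)).
  have -> : \prod_(G in covectors A | zeros G != set0)
      (1 - face_weight (@h I) G) ^+ b G
    = \prod_(G in val @: [set F | F \notin chambers A])
      (1 - face_weight (@h I) G) ^+ b G.
    apply: eq_bigl => G; apply/andP/imsetP => [[GL G0]|[F + ->]].
      have [F FG] := covector_face GL; exists F => //.
      by rewrite inE chambersE FG.
    by rewrite inE chambersE face_covector.
  rewrite big_imset /=; last by move=> ? ? _ _; apply: val_inj.
  by apply: eq_big => [F|F _]; rewrite ?inE // weightE /b valK.
move=> _ /covector_face[F <-]; rewrite -chambersE => /hbeta[H HF betaE].
by exists H; rewrite -?localizationE // /b valK betaE card_chambers_at.
Qed.
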